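(* Let $k\ge1$ be an integer. For every rooted graph $\mathbb G_n\in\mathcal G_n$, $$\mathcal X_n:=\mathcal K(\mathbb P_n)\preceq\mathcal K(\mathbb G_n).$$ Therefore, as $n\to\infty$, $$\min_{\mathbb G_n\in\mathcal G_n}\mathbf E[\mathcal K(\mathbb G_n)]\ \ge\ \mathbf E[\mathcal X_n]\ \sim\ \begin{cases}\dfrac{(k!)^{1/k}}{k-1}\,\Gamma(1/k)\,n^{1-\frac1k}& (k\ge2),\\[1.5ex] \log n&(k=1).\end{cases}$$
   Context: A rooted graph is a connected graph with exactly one node labeled as the root; $\mathcal G_n$ is the set of rooted graphs with $n$ nodes. The $k$-cut number $\mathcal K(\mathbb G_n)$ is the (random) total number of cuts in the following process: (1) choose a node uniformly at random from the component (of the current graph) containing the root and cut it once; (2) if this node has now been cut $k$ times, remove it together with the edges attached to it; (3) if the root has been removed, stop; otherwise go to (1). $\mathbb P_n$ is the path with $n$ nodes, rooted at one of its endpoints. $X\preceq Y$ means that $X$ is stochastically dominated by $Y$, i.e. $\mathbf P\{X\ge x\}\le\mathbf P\{Y\ge x\}$ for all $x$. $\Gamma$ is the gamma function. *)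

(* Defs.v *)
From HB Require Import structures.
From mathcomp Require Import all_boot all_order all_algebra.
From mathcomp Require Import zify.
From mathcomp Require Import all_classical all_reals all_analysis.
Import numFieldNormedType.Exports.

Set Implicit Arguments.
Unset Strict Implicit.
Unset Printing Implicit Defensive.
Import Order.TTheory GRing.Theory Num.Theory.

Local Open Scope classical_set_scope.
Local Open Scope ring_scope.

Definition is_rooted_graph n (G : 'M[bool]_n * 'I_n) : bool :=
  [&& [forall u, ~~ G.1 u u],
      [forall u, forall v, G.1 u v == G.1 v u] &
      [forall u, forall v, connect (fun x y => G.1 x y) u v]].

(* Finite simple connected graph on 'I_n with a distinguished root, given by
   its adjacency matrix; encoded as a subtype so that it is a finType. *)
Record rooted_graph n := RootedGraph {
  graph_data :> 'M[bool]_n * 'I_n ;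
  _ : is_rooted_graph graph_data }.

HB.instance Definition _ n := [isSub for @graph_data n].
HB.instance Definition _ n := [Finite of rooted_graph n by <:].

Definition graph_edge n (G : rooted_graph n) : rel 'I_n := fun u v => G.1 u v.
Definition graph_root n (G : rooted_graph n) : 'I_n := G.2.

Definition path_data n : 'M[bool]_n.+1 * 'I_n.+1 :=
  (\matrix_(i, j) ((j == i.+1 :> nat) || (i == j.+1 :> nat)), ord0).

Lemma path_dataP n : is_rooted_graph (path_data n).
Proof.
apply/and3P; split.
- by apply/forallP => u; rewrite mxE orbb; lia.
- by apply/forallP => u; apply/forallP => v; rewrite !mxE orbC.
pose e : rel 'I_n.+1 := fun x y => (path_data n).1 x y.
have sym_e : connect_sym e.
  by apply: sym_connect_sym => x y; rewrite /e !mxE orbC.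
have c0 m (hm : (m < n.+1)%N) : connect e ord0 (Ordinal hm).
  elim: m hm => [|m IH] hm; first by rewrite (_ : Ordinal hm = ord0)//; exact/val_inj.
  apply: (connect_trans (IH (ltnW hm))); apply: connect1.
  by rewrite /e !mxE /= eqxx.
apply/forallP => u; apply/forallP => v; rewrite -/e; apply: (@connect_trans _ _ ord0).
  by rewrite sym_e; case: u => m hm; exact: c0.
by case: v => m hm; exact: c0.
Qed.

(* The path with n + 1 nodes, rooted at an endpoint. *)
Definition path_graph n : rooted_graph n.+1 := RootedGraph (path_dataP n).

Section kcut_process.
Context {R : realType} (k n : nat) (G : rooted_graph n).
Implicit Types (h s : seq 'I_n) (u v : 'I_n).

(* A history h lists the nodes cut so far, one entry per cut, latest first. *)
Definition removed h v : bool := (k <= count_mem v h)%N.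

(* Meaningful as long as the root is not removed. *)
Definition root_component h : {set 'I_n} :=
  [set v | connect (fun x y => [&& graph_edge G x y, ~~ removed h x & ~~ removed h y])
                   (graph_root G) v]%SET.

(* Probability that, after the history h, the process cuts successively
   exactly the nodes listed in s (earliest first) and then stops because the
   root has just been removed. *)
Fixpoint run_weight h s : R :=
  match s with
  | [::] => (removed h (graph_root G))%:R
  | v :: s' =>
      if removed h (graph_root G) then 0 else
      if v \in root_component h
      then #|root_component h|%:R^-1 * run_weight (v :: h) s' else 0
  end.

Lemma run_weight_ge0 h s : 0 <= run_weight h s.
Proof.
elim: s h => [|v s IH] h /=; first exact: ler0n.
by case: ifP => // _; case: ifP => // _; rewrite mulr_ge0 // invr_ge0 ler0n.
Qed.

Lemma root_component_alive h v : ~~ removed h (graph_root G) ->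
  v \in root_component h -> ~~ removed h v.
Proof.
move=> hr; rewrite inE => /connectP[p].
elim/last_ind: p => [_ ->//|p x _]; rewrite rcons_path last_rcons.
by move=> /andP[_ /and3P[_ _ nx]] ->.
Qed.

Definition cuts_left h : nat := \sum_v (k - count_mem v h)%N.

Lemma cuts_left_cons h v : ~~ removed h v ->
  cuts_left h = (cuts_left (v :: h)).+1.
Proof.
rewrite /removed -ltnNge => hv; rewrite /cuts_left (bigD1 v) //=.
rewrite [in RHS](bigD1 v) //= eqxx.
rewrite [X in (_ + X)%N = _](eq_bigr (fun i => k - ((v == i) + count_mem i h))%N).
  by rewrite -addSn add1n -subSn // subSS.
by move=> i /negbTE iv; rewrite eq_sym iv.
Qed.

Definition bseq_of_option m (o : option ('I_n * m.-bseq 'I_n)) :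
    m.+1.-bseq 'I_n :=
  if o is Some p then [bseq of p.1 :: p.2] else [bseq].

Definition option_of_bseq m (s : m.+1.-bseq 'I_n) :
    option ('I_n * m.-bseq 'I_n) :=
  if (s : seq _) is v :: s' then Some (v, insub_bseq m s') else None.

Lemma bseq_of_option_bij m : bijective (@bseq_of_option m).
Proof.
exists (@option_of_bseq m) => [[[v s]|]|s] //=.
  rewrite /option_of_bseq /=; congr (Some (v, _)); apply: val_inj.
  by rewrite /insub_bseq /= val_insubd size_bseq.
case: s => [[|v s] hs]; apply: val_inj => //=.
by rewrite /option_of_bseq /= /insub_bseq val_insubd -ltnS hs.
Qed.

Lemma sum_bseqS m (F : seq 'I_n -> R) :
  \sum_(s : m.+1.-bseq 'I_n) F s =
  F [::] + \sum_v \sum_(s : m.-bseq 'I_n) F (v :: s).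
Proof.
rewrite (reindex _ (onW_bij _ (bseq_of_option_bij m))) /=.
rewrite (bigD1 None) //= pair_big /=; congr (_ + _).
rewrite (reindex_onto Some (odflt (graph_root G, [bseq]))) /=.
  by apply: eq_bigl => p; rewrite eqxx.
by case.
Qed.

Lemma sum_run_weight m h : (cuts_left h <= m)%N ->
  \sum_(s : m.-bseq 'I_n) run_weight h s = 1.
Proof.
elim: m h => [|m IH] h hm.
  rewrite (bigD1 [bseq]) //= big1 => [|s]; last first.
    by rewrite (bseq0 s) eqxx.
  rewrite addr0 (_ : removed h _ = true) //.
  apply/negPn/negP => /cuts_left_cons; lia.
rewrite sum_bseqS /=.
have [hr|hr] := boolP (removed h (graph_root G)).
  by rewrite big1 ?addr0 // => v _; rewrite big1.
rewrite add0r (bigID (mem (root_component h))) /= [X in _ + X]big1 ?addr0;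
  last by move=> v /negbTE vC; rewrite big1 // => s _; rewrite vC.
rewrite (eq_bigr (fun=> #|root_component h|%:R^-1)) => [|v vC].
  rewrite sumr_const -[X in X *+ _]mulr1 -mulrnAr mulVf //.
  rewrite pnatr_eq0 -lt0n card_gt0; apply/set0Pn; exists (graph_root G).
  by rewrite inE connect0.
rewrite vC -mulr_sumr IH ?mulr1 //.
by have := cuts_left_cons (root_component_alive hr vC); lia.
Qed.

End kcut_process.

(* Sample space: the sequence of nodes cut until the root is removed.
   At most k * n cuts are ever made. *)
Definition run (k n : nat) : Type := (k * n).-bseq 'I_n.

HB.instance Definition _ k n := Finite.on (run k n).
HB.instance Definition _ k n := @isPointed.Build (run k n) [bseq].
HB.instance Definition _ k n := @isMeasurable.Build default_measure_display
  (run k n) discrete_measurable discrete_measurable0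
  discrete_measurableC discrete_measurableU.

Section kcut_number.
Context (R : realType) (k n : nat) (G : rooted_graph n).

Definition kcut_prob (A : set (run k n)) : \bar R :=
  (\sum_(s : run k n) (run_weight k G [::] s)%:E * \d_s A)%E.

Let kcut_prob0 : kcut_prob set0 = 0%E.
Proof. by rewrite /kcut_prob big1 // => s _; rewrite measure0 mule0. Qed.

Let kcut_prob_ge0 A : (0 <= kcut_prob A)%E.
Proof.
by apply: sume_ge0 => s _; rewrite mule_ge0 // lee_fin run_weight_ge0.
Qed.

Let kcut_prob_sigma_additive : semi_sigma_additive kcut_prob.
Proof.
move=> F mF tF mUF; rewrite [X in _ --> X](_ : _ =
    lim ((fun m => \sum_(0 <= i < m) kcut_prob (F i))%E @ \oo)).
  by apply: is_cvg_ereal_nneg_natsum => m _; exact: kcut_prob_ge0.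
rewrite nneseries_sum; last first.
  by move=> s j _; rewrite mule_ge0 // lee_fin run_weight_ge0.
apply: eq_bigr => s _; rewrite nneseriesZl //.
by congr (_ * _)%E; apply/esym/cvg_lim => //; exact: measure_semi_sigma_additive.
Qed.

HB.instance Definition _ := isMeasure.Build _ _ _ kcut_prob
  kcut_prob0 kcut_prob_ge0 kcut_prob_sigma_additive.

Let kcut_prob_setT : kcut_prob setT = 1%E.
Proof.
rewrite /kcut_prob (eq_bigr (fun s : run k n => (run_weight k G [::] s)%:E));
  last by move=> s _; rewrite diracT mule1.
rewrite sumEFin sum_run_weight // /cuts_left (eq_bigr (fun=> k)).
  by rewrite sum_nat_const card_ord mulnC.
by move=> v _; rewrite subn0.
Qed.

HB.instance Definition _ := Measure_isProbability.Build _ _ _ kcut_prob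
  kcut_prob_setT.

Definition total_cuts (s : run k n) : R := (size s)%:R.

Let measurable_total_cuts : measurable_fun setT total_cuts.
Proof. by []. Qed.

HB.instance Definition _ := isMeasurableFun.Build _ _ _ _ total_cuts
  measurable_total_cuts.

Definition kcut_number : {RV kcut_prob >-> R} := total_cuts.

End kcut_number.

Arguments kcut_prob R k {n} G A.
Arguments kcut_number R k {n} G.

Definition stoch_dominated (R : realType) d1 d2
    (T1 : measurableType d1) (T2 : measurableType d2)
    (P1 : probability T1 R) (P2 : probability T2 R)
    (X : {RV P1 >-> R}) (Y : {RV P2 >-> R}) : Prop :=
  forall x : R, (P1 [set w | (x <= X w)%R] <= P2 [set w | (x <= Y w)%R])%E.

(* Euler's integral; used for a > 0. *)
Definition Gamma (R : realType) (a : R) : R :=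
  \int[lebesgue_measure]_(x in `]0, +oo[%classic) (x `^ (a - 1) * expR (- x)).

(* Main.v *)
Require Import Defs.
From mathcomp Require Import all_boot all_order all_algebra.
From mathcomp Require Import zify ring lra.
From mathcomp Require Import all_classical all_reals all_analysis.
From mathcomp Require Import measurable_realfun.
Import numFieldNormedType.Exports.
Import Order.TTheory GRing.Theory Num.Theory.
Local Open Scope classical_set_scope.
Local Open Scope ring_scope.

Set Implicit Arguments.
Unset Strict Implicit.
Unset Printing Implicit Defensive.

(* Domination: order the nodes of G so that each node after the root has an
   earlier neighbour, and identify node i of the path with the i-th node of
   this order. As long as no node of the path component has been cut more often
   in G than in the path, the path component sits inside the root component of
   G; a cut of G outside the path component is ignored by the path, and the
   other cuts of G are uniform on the path component.

   Expectation: if every node is cut at rate 1 in continuous time, a node with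
   c cuts left survives time x with probability Q_c(x) = exp(-x) sum_(a < c)
   x^a / a!, and the mean number of cuts is the integral over time of the mean
   size of the root component, sum_(1 <= i <= n) int_0^oo Q_k^i for the path with n
   nodes. In discrete time, this formula satisfies the recursion of the process
   because Q_c' = Q_(c-1) - Q_c.

   Asymptotics: exp(-x^k/k!) <= Q_k(x), and Q_k(x) <= exp(-exp(-d) x^k/k!) for
   x <= d, so that int Q_k^i ~ int exp(-i x^k/k!) = (k!/i)^(1/k) Gamma(1/k) / k,
   which is then summed over i. For k = 1 the integral is exactly 1/i. *)

(** * Means over the runs of the process *)

(** Mean of [phi] of the number of further cuts after the history [h], restricted to runs of at most
    [m] cuts; no mass is lost once [m] reaches [cuts_left k h]. *)
Definition run_mean (R : realType) (k n : nat) (G : rooted_graph n) m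
    (h : seq 'I_n) (phi : nat -> R) : R :=
  \sum_(s : m.-bseq 'I_n) run_weight k G h s * phi (size s).

Section run_mean.
Context {R : realType} (k n : nat) (G : rooted_graph n).
Implicit Types (h : seq 'I_n) (phi : nat -> R).

Lemma run_mean_stop m h phi : removed k h (graph_root G) ->
  run_mean k G m h phi = phi 0%N.
Proof.
move=> hr; rewrite /run_mean; case: m => [|m].
  rewrite (bigD1 [bseq]) //= big1 => [|s]; last by rewrite (bseq0 s) eqxx.
  by rewrite addr0 hr mul1r.
rewrite (sum_bseqS G m (fun s => run_weight k G h s * phi (size s))) /= hr mul1r.
by rewrite big1 ?addr0 // => v _; rewrite big1 // => s _; rewrite mul0r.
Qed.

(** Conditioning on the first cut: [phi \o S] counts that cut, and one cut fewer remains allowed. *)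
Lemma run_mean_step m h phi : ~~ removed k h (graph_root G) ->
  run_mean k G m.+1 h phi = #|root_component k G h|%:R^-1 *
    \sum_(v in root_component k G h) run_mean k G m (v :: h) (phi \o S).
Proof.
move=> hr.
rewrite /run_mean (sum_bseqS G m (fun s => run_weight k G h s * phi (size s))) /=.
rewrite (negbTE hr) mul0r add0r mulr_sumr [RHS]big_mkcond; apply: eq_bigr => v _.
case: ifP => vC; last by rewrite big1 // => s _; rewrite mul0r.
by rewrite mulr_sumr; apply: eq_bigr => s _; rewrite mulrA.
Qed.

Lemma card_root_component_neq0 h : #|root_component k G h|%:R != 0 :> R.
Proof.
rewrite pnatr_eq0 -lt0n card_gt0; apply/set0Pn; exists (graph_root G).
by rewrite inE connect0.
Qed.

Lemma run_mean_le m h phi psi : (forall i, phi i <= psi i) ->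
  run_mean k G m h phi <= run_mean k G m h psi.
Proof.
by move=> le_phi; apply: ler_sum => s _; rewrite ler_wpM2l // run_weight_ge0.
Qed.

Lemma run_mean_cst m h (c : R) : (cuts_left k h <= m)%N ->
  run_mean k G m h (fun=> c) = c.
Proof. by move=> hm; rewrite /run_mean -mulr_suml sum_run_weight ?mul1r. Qed.

Lemma cuts_left_gt0 h : ~~ removed k h (graph_root G) -> (0 < cuts_left k h)%N.
Proof. by move=> /cuts_left_cons ->. Qed.

Lemma cuts_left_step m h v : ~~ removed k h (graph_root G) ->
  v \in root_component k G h -> (cuts_left k h <= m.+1)%N ->
  (cuts_left k (v :: h) <= m)%N.
Proof.
by move=> hr vC; rewrite (cuts_left_cons (root_component_alive hr vC)).
Qed.

Lemma cuts_left_nil : cuts_left k ([::] : seq 'I_n) = (k * n)%N.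
Proof.
rewrite /cuts_left (eq_bigr (fun=> k)); last by move=> v _; rewrite subn0.
by rewrite sum_nat_const card_ord mulnC.
Qed.

End run_mean.

(** * The root component of the path *)

Section path_component.
Context (k n : nat).
Implicit Types (h : seq 'I_n.+1).

(** A walk on the path changes the index by one at each step, so it cannot jump over a removed node.
    An alive root is assumed because [root_component] always contains the root, even a removed
    one. *)
Lemma path_componentP h (v : 'I_n.+1) : ~~ removed k h (graph_root (path_graph n)) ->
  reflect (forall j : 'I_n.+1, (j <= v)%N -> ~~ removed k h j)
          (v \in root_component k (path_graph n) h).
Proof.
move=> hr; apply: (iffP idP) => [|alive].
  rewrite inE => /connectP[p].
  elim/last_ind: p v => [v _ -> j|p x IH v].
    by rewrite leqn0 => /eqP j0; rewrite (_ : j = graph_root (path_graph n)) //;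
      exact/val_inj.
  rewrite rcons_path last_rcons => /andP[pp /and3P[e _ ax]] -> j jx.
  have {}IH := IH _ pp erefl.
  move: e; rewrite /graph_edge mxE => /orP[/eqP ex|/eqP ex].
    have [jv|jv] := leqP j (last (graph_root (path_graph n)) p); first exact: IH.
    rewrite (_ : j = x) //; apply/val_inj/eqP => /=.
    by rewrite eqn_leq jx ex.
  by apply: IH; rewrite ex leqW.
case: v alive => m hm alive; elim: m hm alive => [|m IH] hm alive.
  by rewrite inE (_ : Ordinal hm = graph_root (path_graph n)) ?connect0//;
    exact/val_inj.
have := IH (ltnW hm); rewrite !inE => /(_ _)/connect_trans -> //.
  by move=> j jm; apply: alive; exact: leq_trans jm _.
by apply: connect1; rewrite /graph_edge mxE /= eqxx /= !alive.
Qed.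

End path_component.

(** * Domination by a coupling *)

Section domination.
Context {R : realType} (k n : nat) (G : rooted_graph n.+1).

(** The list grows from the root one node at a time: by connectivity some edge leaves it until it is
    full, and the outer endpoint is appended. *)
Lemma connected_order : exists s : 'I_n.+1 -> 'I_n.+1,
  [/\ injective s, s ord0 = graph_root G &
      forall i, i != ord0 -> exists2 j : 'I_n.+1, (j < i)%N & graph_edge G (s j)
        (s i)].
Proof.
set r := graph_root G.
suff [s [us ss s0 sP]] : exists s : seq 'I_n.+1, [/\ uniq s, size s = n.+1, nth r
  s 0 = r &
    forall i, (0 < i < n.+1)%N -> exists2 j, (j < i)%N & graph_edge G (nth r s j)
      (nth r s i)].
  exists (fun i => nth r s i); split => //.
    by move=> i j /eqP; rewrite nth_uniq ?ss // => /eqP/val_inj.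
  move=> i; rewrite -val_eqE /= => i0.
  have [|j ji e] := sP i; first by rewrite ltn_ord andbT lt0n.
  by exists (Ordinal (ltn_trans ji (ltn_ord i))).
suff: forall m, (m <= n)%N -> exists s : seq 'I_n.+1, [/\ uniq s, size s = m.+1,
  nth r s 0 = r &
    forall i, (0 < i < m.+1)%N -> exists2 j, (j < i)%N & graph_edge G (nth r s j)
      (nth r s i)].
  by move/(_ n (leqnn _)).
elim => [_|m IH mn].
  by exists [:: r]; split => // i; lia.
have [s [us ss s0 sP]] := IH (ltnW mn).
have [x [y [xs ys e]]] : exists x y, [/\ x \in s, y \notin s & graph_edge G x y].
  have [y ys] : exists y, y \notin s.
    apply/existsP; rewrite -negb_forall; apply/negP => /forallP all_s.
    have: (#|'I_n.+1| <= size s)%N.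
      by rewrite -(card_uniqP us); apply/subset_leq_card/fintype.subsetP.
    by rewrite card_ord ss; lia.
  (* If no edge left [s], then [s] would be closed under adjacency, and a walk from the root to [y]
     could never leave it. *)
  apply: contrapT => nex.
  have cl x z : graph_edge G x z -> x \in s -> z \in s.
    move=> e xs; apply: contrapT => /negP zs; apply: nex; exists x, z; split => //.
  have /connectP[p pp ylast] : connect (fun x y => G.1 x y) r y.
    case: G => /= ? /and3P[_ _ /forallP/(_ r)/forallP]; exact.
  suff : y \in s by rewrite (negbTE ys).
  have rs : r \in s by rewrite -s0 mem_nth // ss.
  have last_s q z : z \in s -> path (fun x y => G.1 x y) z q -> last z q \in s.
    elim: q z => //= w q IHq z zs /andP[e]; apply: IHq; exact: cl zs.
  by rewrite ylast; exact: last_s.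
exists (rcons s y); split => //.
- by rewrite rcons_uniq ys.
- by rewrite size_rcons ss.
- by rewrite nth_rcons ss.
move=> i /andP[i0]; rewrite ltnS leq_eqVlt => /orP[/eqP ->|im].
  exists (index x s); first by rewrite -ss index_mem.
  by rewrite !nth_rcons ss ltnn eqxx -ss index_mem xs nth_index.
have [|j ji e'] := sP i; first by rewrite i0.
by exists j => //; rewrite !nth_rcons ss im (ltn_trans ji im).
Qed.

(** The coupling as an induction over the cuts of G alone: each cut of G is either copied by the
    path or ignored by it, so [m'] need not decrease with [m]. The last hypothesis is the invariant
    of the coupling, required only while the path root is alive. *)
Lemma run_mean_path_le (s : 'I_n.+1 -> 'I_n.+1) :
  injective s -> s ord0 = graph_root G ->
  (forall i, i != ord0 -> exists2 j : 'I_n.+1, (j < i)%N & graph_edge G (s j) (s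
    i)) ->
  forall m m' h h' (phi : nat -> R), {homo phi : i j / (i <= j)%N >-> i <= j} ->
  (cuts_left k h <= m)%N -> (cuts_left k h' <= m')%N ->
  (~~ removed k h' (graph_root (path_graph n)) ->
   {in root_component k (path_graph n) h',
    forall v, (count_mem (s v) h <= count_mem v h')%N}) ->
  run_mean k (path_graph n) m' h' phi <= run_mean k G m h phi.
Proof.
move=> s_inj s0 sP; elim => [|m IH] m' h h' phi phi_homo hm hm' inv.
  (* With no cut left, the root of G is removed, and the invariant at the root forces the path root
     to be removed as well. *)
  have hr : removed k h (graph_root G).
    by apply/negPn/negP => /cuts_left_gt0; lia.
  rewrite (run_mean_stop _ _ hr);
    have [hr'|hr'] := boolP (removed k h' (graph_root (path_graph n))).
    by rewrite run_mean_stop.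
  have rA : graph_root (path_graph n) \in root_component k (path_graph n) h'.
    by rewrite inE connect0.
  have := inv hr' _ rA; rewrite (_ : s _ = graph_root G) // => /(leq_trans hr).
  by move/negP : hr'.
have [hr'|hr'] := boolP (removed k h' (graph_root (path_graph n))).
  rewrite (run_mean_stop _ _ hr') -[leLHS](@run_mean_cst _ k _ G m.+1 h) //.
  by apply: run_mean_le => i; exact: phi_homo.
have {}inv := inv hr'.
set P := path_graph n in hr' inv *.
set T := run_mean k P m' h' phi.
have alive v : v \in root_component k P h' -> ~~ removed k h (s v).
  move=> vA; have /path_componentP-/(_ hr' v (leqnn _)) := vA.
  by apply: contraNN => /leq_trans; apply; exact: inv.
have hr : ~~ removed k h (graph_root G).
  by rewrite -s0; apply: alive; rewrite inE (_ : graph_root P = ord0).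
(* Strong induction on the index: the earlier neighbour of [s v] lies in the root component of G,
   and the edge to it joins two alive nodes. *)
have sA v : v \in root_component k P h' -> s v \in root_component k G h.
  have [N] := ubnP (val v); elim: N v => // N IHN v; rewrite ltnS => vN vA.
  have [->|v0] := eqVneq v ord0; first by rewrite s0 inE.
  have [j jv e] := sP _ v0.
  have jA : j \in root_component k P h'.
    apply/(path_componentP _ hr') => i ij.
    by move/(path_componentP _ hr') : vA; apply; exact: leq_trans ij (ltnW jv).
  have := IHN j (leq_trans jv vN) jA; rewrite !inE => /connect_trans; apply.
  by apply: connect1; rewrite e !alive.
have A0 : 0 < #|root_component k G h|%:R :> R.
  by rewrite lt_neqAle ler0n andbT eq_sym card_root_component_neq0.
rewrite run_mean_step // mulrC ler_pdivlMr //.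
set A := root_component k G h; set A' := root_component k P h'.
pose sA' := [set s v | v in A']%SET.
have sA'A : sA' \subset A by apply/fintype.subsetP => _ /imsetP[v vA' ->]; exact: sA.
rewrite mulr_natr -sumr_const (big_setID sA') [leRHS](big_setID sA') /=.
rewrite (finset.setIidPr sA'A); apply: lerD; last first.
  (* A cut outside the image: the path keeps its history, and replacing [phi] by [phi \o S] only
     increases its mean. *)
  apply: ler_sum => v; rewrite finset.in_setD => /andP[vsA' vA].
  apply: (@le_trans _ _ (run_mean k P m' h' (phi \o S))).
    by apply: run_mean_le => i; apply: phi_homo.
  apply: IH => //.
  - by move=> i j ij; apply: phi_homo.
  - exact: cuts_left_step hr vA hm.
  - move=> _ w wA' /=; rewrite (_ : (v == s w) = false) ?inv //.
    by apply: contraNF vsA' => /eqP ->; apply/imsetP; exists w.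
rewrite !big_imset /=; [|by move=> ? ? _ _; exact: s_inj..].
rewrite sumr_const -mulr_natr /T.
case: m' hm' @T => [|m'] hm' T.
  (* The path root is alive, so a bound of zero cuts is impossible. *)
  by have := cuts_left_gt0 hr'; lia.
(* On the image, [#|A'|] copies of [T] add up to the sum over the first cut of the path, which is
   compared term by term with the matching cuts of G. *)
rewrite /T run_mean_step // mulrC mulVKf ?card_root_component_neq0 //.
apply: ler_sum => v vA'; apply: IH => //.
- by move=> i j ij; apply: phi_homo.
- exact: cuts_left_step hr (sA _ vA') hm.
- exact: cuts_left_step hr' vA' hm'.
(* Both counts of [w] grow by the same amount as [s] is injective, and a node in the component after
   the cut was in it before. *)
- move=> hvr w wA' /=; rewrite inj_eq // leq_add2l; apply: inv.
  apply/(path_componentP _ hr') => j jw.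
  have /(path_componentP _ hvr)/(_ j jw) := wA'.
  by apply: contraNN; rewrite /removed /= => /leq_trans; apply; exact: leq_addl.
Qed.

Lemma run_mean_path_min (phi : nat -> R) : {homo phi : i j / (i <= j)%N >-> i <= j} ->
  run_mean k (path_graph n) (k * n.+1) [::] phi <= run_mean k G (k * n.+1) [::] phi.
Proof.
have [s [s_inj s0 sP]] := connected_order => phi_homo.
by apply: (run_mean_path_le s_inj s0 sP) => //; rewrite cuts_left_nil.
Qed.

End domination.

(** * Tail probabilities and expectation as means over runs *)

Section kcut_number_mean.
Context {R : realType} (k n : nat) (G : rooted_graph n).

Lemma kcut_prob_ge (x : R) :
  kcut_prob R k G [set w | x <= kcut_number R k G w] =
  (run_mean k G (k * n) [::] (fun i => (x <= i%:R)%R%:R)%R)%:E.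
Proof.
rewrite /run_mean -sumEFin; apply: eq_bigr => s _.
rewrite EFinM; congr (_ * _)%E; rewrite diracE; congr ((nat_of_bool _)%:R%:E).
by apply/idP/idP; rewrite inE.
Qed.

Lemma kcut_number_expectation :
  ('E_(kcut_prob R k G)[kcut_number R k G])%E =
  (run_mean k G (k * n) [::] (fun i => i%:R))%:E.
Proof.
rewrite unlock.
(* The sample space as a finite union of singletons turns the integral into a finite sum. *)
have -> : [set: run k n] = \big[setU/set0]_(s <- enum {: run k n}) [set s].
  apply/esym; rewrite -subTset => s _; rewrite -bigcup_seq; exists s => //=.
  by rewrite mem_enum.
rewrite ge0_integral_bigsetU //=; last 3 first.
- exact: enum_uniq.
- by move=> s t _ _ [u [-> ->]].
- by move=> s _; rewrite lee_fin ler0n.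
rewrite big_enum /run_mean -sumEFin; apply: eq_bigr => s _.
rewrite (eq_integral (cst (size s)%:R%:E)); last by move=> t /[!inE] ->.
rewrite integral_cst // muleC EFinM; congr (_ * _)%E.
rewrite /= /kcut_prob (bigD1 s) //= diracE in_set1 eqxx mule1 big1 ?adde0 // => t ts.
by rewrite diracE in_set1 (negbTE ts) mule0.
Qed.

End kcut_number_mean.

(** * Tails of Gamma variables *)

Section gamma_tail.
Context {R : realType}.
Implicit Types (c : nat) (x : R).

(* The probability that a Gamma(c) variable exceeds x, that is, that a node
   with c cuts left survives up to time x when it is cut at rate 1. *)
Definition gamma_tail c x : R := expR (- x) * \sum_(a < c) x ^+ a / a`!%:R.

Lemma gamma_tail0 x : gamma_tail 0 x = 0.
Proof. by rewrite /gamma_tail big_ord0 mulr0. Qed.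

Lemma gamma_tailS c x :
  gamma_tail c.+1 x = gamma_tail c x + expR (- x) * (x ^+ c / c`!%:R).
Proof. by rewrite /gamma_tail big_ord_recr /= mulrDr. Qed.

Lemma gamma_tail_at0 c : (0 < c)%N -> gamma_tail c 0 = 1.
Proof.
case: c => // c _; rewrite /gamma_tail oppr0 expR0 mul1r big_ord_recl /= expr0
  fact0 divr1.
by rewrite big1 ?addr0 // => i _; rewrite expr0n /= mul0r.
Qed.

Lemma gamma_tail_ge0 c x : 0 <= x -> 0 <= gamma_tail c x.
Proof.
move=> x0; rewrite mulr_ge0 ?expR_ge0 // sumr_ge0 // => a _.
by rewrite divr_ge0 ?exprn_ge0.
Qed.

Lemma gamma_tail_pred_le c x : 0 <= x -> gamma_tail c.-1 x <= gamma_tail c x.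
Proof.
move=> x0; case: c => // c /=; rewrite gamma_tailS lerDl.
by rewrite mulr_ge0 ?expR_ge0 ?divr_ge0 ?exprn_ge0.
Qed.

Global Instance is_derive_taylor_term c x :
  is_derive x 1 (fun y : R => y ^+ c / c`!%:R)
    (if c is a.+1 then x ^+ a / a`!%:R else 0).
Proof.
have -> : (fun y : R => y ^+ c / c`!%:R) = c`!%:R^-1 \*: (@id R ^+ c).
  by apply/funext => y; rewrite !fctE [y ^+ c / _]mulrC.
apply: is_derive_eq; rewrite /GRing.scale /= mulr1.
case: c => [|a] /=; first by rewrite mul0r mulr0.
by rewrite factS natrM; field; rewrite nat1r !pnatr_eq0 -lt0n fact_gt0.
Qed.

Lemma is_derive_gamma_term c x :
  is_derive x 1 (fun y : R => expR (- y) * (y ^+ c / c`!%:R))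
    (expR (- x) * (if c is a.+1 then x ^+ a / a`!%:R else 0) -
     expR (- x) * (x ^+ c / c`!%:R)).
Proof.
have dN : is_derive x 1 (fun y : R => expR (- y)) (- expR (- x)).
  by rewrite -mulrN1; exact: (@is_derive1_comp _ expR -%R).
have -> : (fun y : R => expR (- y) * (y ^+ c / c`!%:R)) =
  (fun y => expR (- y)) * (fun y => y ^+ c / c`!%:R) by [].
apply: is_derive_eq; rewrite /GRing.scale /=.
by rewrite mulrN [X in _ - X]mulrC.
Qed.

(** Each Poisson weight has as derivative the previous weight minus itself, so the sum telescopes.
    For [c = 0] the predecessor is again 0 and both sides vanish. *)
Global Instance is_derive_gamma_tail c x :
  is_derive x 1 (gamma_tail c) (gamma_tail c.-1 x - gamma_tail c x).
Proof.
elim: c => [|c IH] /=.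
  rewrite subrr (_ : gamma_tail 0 = cst 0); first exact: is_derive_cst.
  by apply/funext => y; rewrite gamma_tail0.
rewrite [X in is_derive _ _ X](_ : _ = gamma_tail c + fun y => expR (- y) * (y ^+
  c / c`!%:R)); last first.
  by apply/funext => y; rewrite gamma_tailS.
have := is_derive_gamma_term c x => dt.
by apply: is_derive_eq; case: c {IH dt} => [|c] /=;
  rewrite !gamma_tailS ?gamma_tail0; ring.
Qed.

Lemma continuous_gamma_tail c : continuous (gamma_tail c).
Proof.
move=> x; apply: differentiable_continuous; apply/derivable1_diffP.
exact: ex_derive.
Qed.

(** A crude bound for the limit at infinity: half of the exponential absorbs [(x / 2) ^+ a / a!],
    and the remaining factors [2 ^ a] sum to less than [2 ^ c]. *)
Lemma gamma_tail_le_exp c x : 0 <= x -> gamma_tail c x <= (2 ^ c)%:R * expR (- (x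
  / 2)).
Proof.
move=> x0; have x20 : 0 <= x / 2 by rewrite divr_ge0.
have term a : expR (- x) * (x ^+ a / a`!%:R) <= (2 ^ a)%:R * expR (- (x / 2)).
  have e2 : (x / 2) ^+ a / a`!%:R <= expR (x / 2).
    case: a => [|a]; last by apply: le_trans (expR_ge1Dxn a x20); rewrite lerDr.
    by rewrite expr0 fact0 divr1 (le_trans _ (expR_ge1Dx _)) // lerDl.
  have -> : expR (- x) * (x ^+ a / a`!%:R) =
      (2 ^ a)%:R * expR (- (x / 2)) * (expR (- (x / 2)) * ((x / 2) ^+ a / a`!%:R)).
    have -> : - x = - (x / 2) + - (x / 2) by field.
    rewrite expRD natrX expr_div_n; field.
    by rewrite pnatr_eq0 -lt0n fact_gt0 expf_neq0.
  rewrite ler_piMr ?mulr_ge0 ?expR_ge0 //.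
  by rewrite expRN mulrC ler_pdivrMr ?expR_gt0 // mul1r.
have [->|c0] := posnP c; first by rewrite gamma_tail0 mulr_ge0 // expR_ge0.
have -> : gamma_tail c x = \sum_(a < c) expR (- x) * (x ^+ a / a`!%:R).
  by rewrite /gamma_tail mulr_sumr.
apply: (@le_trans _ _ (\sum_(a < c) (2 ^ a)%:R * expR (- (x / 2)))).
  by apply: ler_sum => a _; exact: term.
rewrite -mulr_suml ler_wpM2r ?expR_ge0 // -natr_sum ler_nat.
elim: c {c0} => [|c IH]; first by rewrite big_ord0.
by rewrite big_ord_recr /= expnS mul2n -addnn leq_add2r.
Qed.

Lemma cvg_gamma_tail c : gamma_tail c x @[x --> +oo] --> 0.
Proof.
apply: (@squeeze_cvgr _ _ _ _ (cst 0) (fun x => (2 ^ c)%:R * expR (- (x / 2)))).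
- near=> x; have x0 : 0 <= x by near: x; apply: nbhs_pinfty_ge.
  by rewrite gamma_tail_ge0 //= gamma_tail_le_exp.
- exact: cvg_cst.
- rewrite -[X in _ --> X](mulr0 ((2 ^ c)%:R)); apply: cvgMr.
  apply: (@cvg_comp _ _ _ (fun x : R => x / 2) (fun x => expR (- x)) _ +oo);
    last exact: cvgr_expR.
  exact: gt0_cvgMly.
Unshelve. all: by end_near. Qed.

End gamma_tail.

(** * Products of Gamma tails *)

Section gamma_tail_product.
Context {R : realType} (I : eqType).
Implicit Types (s : seq I) (c : I -> nat) (x : R).
Notation mu := (@lebesgue_measure R).

(** The product rule, where differentiating the factor at [v] takes one cut from [v]; [uniq s]
    ensures that [v == j] affects a single factor. *)
Lemma is_derive_prod_gamma_tail s c x : uniq s ->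
  is_derive x 1 (fun y : R => \prod_(j <- s) gamma_tail (c j) y)
    (\sum_(v <- s) (\prod_(j <- s) gamma_tail (c j - (v == j)) x -
                    \prod_(j <- s) gamma_tail (c j) x)).
Proof.
elim: s => [_|a s IH /= /andP[aNs us]].
  rewrite [X in is_derive _ _ X _](_ : _ = cst 1); first by rewrite !big_nil;
    exact: is_derive_cst.
  by apply/funext => y; rewrite big_nil.
have {IH} ds := IH us.
rewrite [X in is_derive _ _ X _](_ : _ =
    gamma_tail (c a) * (fun y => \prod_(j <- s) gamma_tail (c j) y)); last first.
  by apply/funext => y; rewrite big_cons.
apply: is_derive_eq; rewrite !big_cons addrC eqxx subn1; congr (_ + _).
  rewrite [X in _ = _ * X - _](_ : _ = \prod_(j <- s) gamma_tail (c j) x).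
    by rewrite -mulrBl mulrC.
  apply: eq_big_seq => j js.
  by rewrite (_ : (a == j) = false) ?subn0 //; apply: contraNF aNs => /eqP ->.
rewrite /GRing.scale /= mulr_sumr; apply: eq_big_seq => v vs.
rewrite !big_cons (_ : (v == a) = false) ?subn0 ?mulrBr //.
by apply: contraNF aNs => /eqP <-.
Qed.

Lemma prod_gamma_tail_ge0 s c x : 0 <= x -> 0 <= \prod_(j <- s) gamma_tail (c j) x.
Proof. by move=> x0; apply: prodr_ge0 => j _; exact: gamma_tail_ge0. Qed.

Lemma continuous_prod_gamma_tail s c :
  continuous (fun x : R => \prod_(j <- s) gamma_tail (c j) x).
Proof.
elim: s => [|a s IH] x.
  under eq_fun do rewrite big_nil; exact: cvg_cst.
under eq_fun do rewrite big_cons.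
by apply: cvgM; [exact: continuous_gamma_tail|exact: IH].
Qed.

Lemma measurable_prod_gamma_tail s c (D : set R) :
  measurable_fun D (fun x : R => \prod_(j <- s) gamma_tail (c j) x).
Proof.
by apply: measurable_funTS; apply: continuous_measurable_fun;
  exact: continuous_prod_gamma_tail.
Qed.

Lemma cvg_prod_gamma_tail s c : s != [::] ->
  \prod_(j <- s) gamma_tail (c j) x @[x --> +oo] --> (0 : R).
Proof.
have cv t : \prod_(j <- t) gamma_tail (c j) x @[x --> +oo] --> (\prod_(j <- t) 0 : R).
  elim: t => [|a t IH].
    by under eq_fun do rewrite big_nil; rewrite big_nil; exact: cvg_cst.
  under eq_fun do rewrite big_cons.
  by rewrite big_cons; apply: cvgM; [exact: cvg_gamma_tail|exact: IH].
by case: s => // a s _; have := cv (a :: s); rewrite [X in _ --> X]big_cons mul0r.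
Qed.

(* Integrating the derivative of the product over [0, +oo[, where the product
   decreases from 1 to 0. *)
Lemma integral_prod_gamma_tail s c : uniq s -> s != [::] ->
  {in s, forall j, (0 < c j)%N} ->
  ((size s)%:R%:E * \int[mu]_(x in `[0%R, +oo[) (\prod_(j <- s) gamma_tail (c j)
    x)%:E =
   1 + \sum_(v <- s) \int[mu]_(x in `[0%R, +oo[)
         (\prod_(j <- s) gamma_tail (c j - (v == j)) x)%:E)%E.
Proof.
move=> us s0 c0.
pose G v (x : R) := \prod_(j <- s) gamma_tail (c j - (v == j)) x.
pose H (x : R) := \prod_(j <- s) gamma_tail (c j) x.
pose f x := \sum_(v <- s) (H x - G v x).
have f_ge0 x : 0 <= x -> 0 <= f x.
  move=> x0; apply: sumr_ge0 => v _; rewrite subr_ge0; apply: ler_prod => j _.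
  rewrite gamma_tail_ge0 //=; case: (v == j); rewrite ?subn0 ?subn1 //.
  exact: gamma_tail_pred_le.
have cf : continuous f.
  rewrite /f; elim: (s) => [|a t IH] x.
    by under eq_fun do rewrite big_nil; exact: cvg_cst.
  under eq_fun do rewrite big_cons.
  apply: cvgD; last exact: IH.
  by apply: cvgB; exact: continuous_prod_gamma_tail.
have dF x : is_derive x 1 (- H) (f x).
  have := is_derive_prod_gamma_tail c x us => dH.
  apply: is_derive_eq; rewrite -sumrN; apply: eq_bigr => v _.
  by rewrite opprB.
have H0 : H 0 = 1.
  by rewrite /H big_seq big1 // => j js; rewrite gamma_tail_at0 // c0.
have int_f : (\int[mu]_(x in `[0%R, +oo[) (f x)%:E = 1)%E.
  rewrite (@ge0_continuous_FTC2y R f (- H) 0 0) //.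
  - by rewrite -EFinB opprfctE H0 opprK add0r.
  - by apply: continuous_subspaceT.
  - rewrite -oppr0; apply: cvgN; exact: cvg_prod_gamma_tail.
  - rewrite fctE; apply: cvgN; apply: cvg_at_right_filter.
    exact: continuous_prod_gamma_tail.
  - by move=> x _; rewrite derive1E derive_val.
(* Pointwise, [f] plus the sum of the [G v] is [size s] times [H]; all integrands are nonnegative,
   so the integrals add up in the extended reals. *)
rewrite -int_f -ge0_integral_sum //; last first.
  by move=> v x /= ; rewrite in_itv /= andbT lee_fin => x0;
    exact: prod_gamma_tail_ge0.
  by move=> v; apply/measurable_EFinP; exact: measurable_prod_gamma_tail.
under [X in (_ = _ + X)%E]eq_integral do rewrite sumEFin.
have x_ge0 x : x \in `[0%R, +oo[ -> 0 <= x by rewrite in_itv /= andbT.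
have sum_ge0 x : x \in `[0%R, +oo[ -> 0 <= \sum_(v <- s) G v x.
  by move=> /x_ge0 x0; apply: sumr_ge0 => v _; exact: prod_gamma_tail_ge0.
rewrite -ge0_integralD //=; last 3 first.
- by move=> x /x_ge0 x0; rewrite lee_fin f_ge0.
- apply/measurable_EFinP/measurable_funTS; exact: continuous_measurable_fun.
- apply/measurable_EFinP; apply: measurable_sum => v;
  exact: measurable_prod_gamma_tail.
rewrite -ge0_integralZl //=; last 2 first.
- by apply/measurable_EFinP; exact: measurable_prod_gamma_tail.
- by move=> x /x_ge0 x0; rewrite lee_fin prod_gamma_tail_ge0.
apply: eq_integral => x _; rewrite -EFinM -EFinD; congr _%:E.
rewrite /f sumrB big_const_seq count_predT iter_addr_0 subrK mulr_natl.
by [].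
Qed.

End gamma_tail_product.

(** * The mean number of cuts on the path as an integral *)

Section path_mean.
Context {R : realType} (k n : nat).
Notation mu := (@lebesgue_measure R).
Implicit Types (h : seq 'I_n.+1) (i j v : 'I_n.+1).

(** The nodes that must all survive for [i] to stay connected to the root. *)
Definition path_prefix i : seq 'I_n.+1 :=
  [seq j : 'I_n.+1 <- enum 'I_n.+1 | (j <= i)%N].

Lemma mem_path_prefix i j : (j \in path_prefix i) = (j <= i)%N.
Proof. by rewrite mem_filter mem_enum andbT. Qed.

Lemma path_prefix_uniq i : uniq (path_prefix i).
Proof. by rewrite filter_uniq // enum_uniq. Qed.

Lemma size_path_prefix i : size (path_prefix i) = i.+1.
Proof.
rewrite -(size_map val) (_ : map val _ = [seq j <- iota 0 n.+1 | (j <= 0 + i)%N]).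
  by rewrite filter_iota_leq // size_iota.
by rewrite -val_enum_ord filter_map.
Qed.

(* The expected time during which node i belongs to the root component, when
   every node is cut at rate 1 from the history h on. *)
Definition alive_time h i : \bar R :=
  \int[mu]_(x in `[0%R, +oo[)
    (\prod_(j <- path_prefix i) gamma_tail (k - count_mem j h) x)%:E.

Lemma alive_time_ge0 h i : (0 <= alive_time h i)%E.
Proof.
apply: integral_ge0 => x; rewrite /= in_itv /= andbT => x0.
by rewrite lee_fin prod_gamma_tail_ge0.
Qed.

Lemma alive_time_eq0 h i j : (j <= i)%N -> removed k h j -> alive_time h i = 0%E.
Proof.
move=> ji hj; apply: integral0_eq => x _; congr _%:E.
rewrite (big_rem j) ?mem_path_prefix //= (_ : (k - _)%N = 0%N).
  by rewrite gamma_tail0 mul0r.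
by apply/eqP; rewrite subn_eq0.
Qed.

Local Notation P := (path_graph n).

(** Cuts of nodes up to [i] are handled by [integral_prod_gamma_tail]; a cut of any other node of
    the component leaves the alive time of [i] unchanged and contributes the same term to both
    sides. *)
Lemma alive_time_step h i : ~~ removed k h (graph_root P) ->
  i \in root_component k P h ->
  (#|root_component k P h|%:R%:E * alive_time h i =
   1 + \sum_(v in root_component k P h) alive_time (v :: h) i)%E.
Proof.
move=> hr iC; set C := root_component k P h.
have alive j : j \in path_prefix i -> ~~ removed k h j.
  by rewrite mem_path_prefix; have /path_componentP-/(_ hr j) := iC.
pose D := [set j in path_prefix i]%SET.
have DC : D \subset C.
  apply/fintype.subsetP => j; rewrite inE mem_path_prefix => ji.
  apply/(path_componentP _ hr) => l lj.
  by have /path_componentP-/(_ hr l) := iC; apply; exact: leq_trans lj ji.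
have sD (F : 'I_n.+1 -> \bar R) :
    (\sum_(v in D) F v = \sum_(v <- path_prefix i) F v)%E.
  rewrite (eq_bigl (fun v => v \in path_prefix i)); last by move=> v; rewrite inE.
  by rewrite big_uniq // path_prefix_uniq.
rewrite (big_setID D) /= (finset.setIidPr DC) sD.
have ne : path_prefix i != [::].
  by apply/eqP => p0; have := mem_path_prefix i i; rewrite p0 leqnn.
have pos : {in path_prefix i, forall j, (0 < k - count_mem j h)%N}.
  by move=> j /alive; rewrite /removed -ltnNge subn_gt0.
have := @integral_prod_gamma_tail R _ _ _ (path_prefix_uniq i) ne pos.
rewrite -/(alive_time h i) => step.
have -> : (#|C| = size (path_prefix i) + #|C :\: D|)%N.
  rewrite -(cardsID D C) (finset.setIidPr DC); congr (_ + _)%N.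
  by rewrite cardsE; apply/card_uniqP/path_prefix_uniq.
rewrite natrD EFinD ge0_muleDl ?lee_fin // step -addeA; congr (1 + (_ + _))%E.
  apply: eq_bigr => v _; apply: eq_integral => x _; congr _%:E.
  by apply: eq_bigr => j _; rewrite /= addnC subnDA.
rewrite (eq_bigr (fun=> alive_time h i)); last first.
  move=> v; rewrite finset.in_setD inE mem_path_prefix => /andP[vi _].
  apply: eq_integral => x _; congr _%:E; apply: eq_big_seq => j.
  rewrite mem_path_prefix => ji /=; rewrite (_ : (v == j) = false) //.
  by apply: contraNF vi => /eqP ->.
by rewrite sumr_const mule_natl.
Qed.

(** By induction on [m]: the sum of the alive times obeys the first-cut recursion of the process. *)
Lemma path_run_mean m h : (cuts_left k h <= m)%N ->
  ((run_mean k P m h (fun i : nat => i%:R))%:E = \sum_i alive_time h i :> \bar R)%E.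
Proof.
elim: m h => [|m IH] h hm.
  have hr : removed k h (graph_root P) by apply/negPn/negP => /cuts_left_gt0; lia.
  by rewrite run_mean_stop // big1 // => i _; rewrite (alive_time_eq0 _ hr).
have [hr|hr] := boolP (removed k h (graph_root P)).
  by rewrite run_mean_stop // big1 // => i _; rewrite (alive_time_eq0 _ hr).
set C := root_component k P h.
have C0 : #|C|%:R != 0 :> R by exact: card_root_component_neq0.
(* A node outside [C] has a removed node at or before it, in [h] and in every later history, so its
   alive time vanishes. *)
have sumC h' : (forall j, removed k h j -> removed k h' j) ->
    (\sum_i alive_time h' i = \sum_(i in C) alive_time h' i)%E.
  move=> hh'; rewrite [RHS]big_mkcond /=; apply: eq_bigr => i _; case: ifPn => // iC.
  have [j ji hj] : exists2 j : 'I_n.+1, (j <= i)%N & removed k h j.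
    apply: contrapT => nj; move/negP : iC; apply;
      apply/(path_componentP _ hr) => j ji.
    by apply/negP => hj; apply: nj; exists j.
  by rewrite (alive_time_eq0 ji) // hh'.
rewrite run_mean_step // sumC //.
have step i : i \in C -> (#|C|%:R%:E * alive_time h i =
   1 + \sum_(v in C) alive_time (v :: h) i)%E by exact: alive_time_step.
have E : (#|C|%:R%:E * \sum_(i in C) alive_time h i =
    \sum_(v in C) (run_mean k P m (v :: h) (fun i : nat => i.+1%:R))%:E)%E.
  rewrite ge0_sume_distrr; last by move=> i _; exact: alive_time_ge0.
  (* After exchanging the sums, the [#|C|] ones coming from the nodes [i] are attributed to the cuts
     [v]: each stands for the cut being made. *)
  rewrite (eq_bigr _ step) big_split /= exchange_big /= -big_split /=.
  apply: eq_bigr => v vC; rewrite -sumC; last first.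
    by move=> j; rewrite /removed /= => /leq_trans; apply; exact: leq_addl.
  have hm' := cuts_left_step hr vC hm.
  rewrite -IH // -[X in (X + _)%E](_ : (run_mean k P m (v :: h) (fun=> 1))%:E = _).
    rewrite -EFinD /run_mean -big_split /=; congr _%:E; apply: eq_bigr => s _.
    by rewrite -mulrDr nat1r.
  by rewrite run_mean_cst.
(* The sum could a priori be [+oo]; multiplied by the positive [#|C|] it would stay infinite,
   against the finite right-hand side. *)
move: E; rewrite sumEFin.
have : (0 <= \sum_(i in C) alive_time h i)%E.
  by apply: sume_ge0 => i _; exact: alive_time_ge0.
case: (\sum_(i in C) _)%E => //= [r _|_].
  rewrite -EFinM => -[<-]; congr _%:E.
  by rewrite mulKf.
by rewrite gt0_muley // lte_fin lt_neqAle eq_sym C0 ler0n.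
Qed.

(** The alive time, from the empty history, of the path node whose prefix has [m] nodes. It is
    infinite at [m = 0], so sums start at 1. *)
Definition mean_alive_time m : \bar R :=
  \int[mu]_(x in `[0%R, +oo[) (gamma_tail k x ^+ m)%:E.

Lemma path_expectation :
  ('E_(kcut_prob R k P)[kcut_number R k P] = \sum_(1 <= i < n.+2) mean_alive_time
    i)%E.
Proof.
rewrite kcut_number_expectation path_run_mean ?cuts_left_nil //.
rewrite big_add1 /= big_mkord; apply: eq_bigr => i _.
apply: eq_integral => x _; congr _%:E.
rewrite (eq_bigr (fun=> gamma_tail k x)) => [|j _]; last by rewrite /= subn0.
by rewrite big_const_seq count_predT size_path_prefix iter_mulr_1.
Qed.

End path_mean.

(** * The integral of exp(- c x^k) through Euler's integral *)

Section power_exponential_integral.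
Context {R : realType}.
Notation mu := (@lebesgue_measure R).

Lemma cvg_powR_pinfty (p : R) : 0 < p -> x `^ p @[x --> +oo] --> +oo.
Proof.
move=> p0; apply/cvgryPge => A; near=> x.
have Mx : Num.max A 1 `^ p^-1 <= x by near: x; apply: nbhs_pinfty_ge;
  rewrite num_real.
rewrite (le_trans (_ : A <= Num.max A 1)) ?le_max ?lexx //.
have M0 : 0 <= Num.max A 1 by rewrite le_max ler01 orbT.
rewrite -[leLHS](powRr1 M0) -(mulVf (lt0r_neq0 p0)) powRrM.
have x0 : 0 <= x by exact: le_trans (powR_ge0 _ _) Mx.
by apply: ge0_ler_powR; rewrite ?nnegrE ?powR_ge0 ?(ltW p0).
Unshelve. all: by end_near. Qed.

Lemma cvg_powR_neg (p : R) : p < 0 -> x `^ p @[x --> +oo] --> 0.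
Proof.
move=> p0; have Np0 : 0 < - p by rewrite oppr_gt0.
rewrite (_ : (fun x : R => x `^ p) = fun x : R => (x `^ (- p))^-1); last first.
  by apply/funext => x; rewrite powRN invrK.
apply/gtr0_cvgV0; last exact: cvg_powR_pinfty.
by near=> x; rewrite powR_gt0.
Unshelve. all: by end_near. Qed.

Lemma powR_root_expr (k : nat) (x : R) : (0 < k)%N -> 0 <= x -> (x `^ k%:R^-1) ^+
  k = x.
Proof.
move=> k0 x0; rewrite -powR_mulrn ?powR_ge0 // -powRrM mulVf ?powRr1 //.
by rewrite pnatr_eq0 -lt0n.
Qed.

Lemma continuous_exp_power (k : nat) (c : R) : continuous (fun x : R => expR (-
  (c * x ^+ k))).
Proof.
move=> x; apply: continuous_comp; last exact: continuous_expR.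
by apply: cvgN; apply: cvgMr; exact: exprn_continuous.
Qed.

Lemma measurable_gamma_density (p : R) (D : set R) :
  measurable_fun D (fun x : R => x `^ p * expR (- x)).
Proof.
apply: measurable_funTS; apply: measurable_funM; first exact: measurable_powR.
by apply: measurableT_comp => //; exact: measurable_expR.
Qed.

(* The substitution x = (t / c)^(1/k). *)
Lemma integral_exp_power_itvcy (k : nat) (c a : R) : (1 < k)%N -> 0 < c -> 0 < a ->
  (\int[mu]_(x in `[((a / c) `^ k%:R^-1)%R, +oo[) (expR (- (c * x ^+ k)))%:E =
  ((c `^ - k%:R^-1) / k%:R)%:E *
  \int[mu]_(x in `[a, +oo[) (x `^ (k%:R^-1 - 1) * expR (- x))%:E)%E.
Proof.
move=> k1 c0 a0; set p : R := k%:R^-1; set q := c `^ - p.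
have p0 : 0 < p by rewrite invr_gt0 ltr0n ltnW.
have p1 : p < 1 by rewrite invf_lt1 ?ltr0n ?(ltnW k1) // ltr1n.
have q0 : 0 < q by rewrite powR_gt0.
(* [F] inverts [c * x ^+ k]. Its derivative is singular at 0 because [p < 1], so the half-line
   starts at [a > 0]. *)
pose F (t : R) := q * t `^ p; pose F' (t : R) := q * (p * t `^ (p - 1)).
pose G (x : R) := expR (- (c * x ^+ k)).
have dF (t : R) : 0 < t -> is_derive t 1 F (F' t).
  move=> t0; have d := is_derive1_powR p t0.
  by rewrite (_ : F = q \*: (fun x : R => x `^ p)) //; apply: is_derive_eq.
have F'E (t : R) : 0 < t -> (F^`()%classic) t = F' t.
  by move=> t0; rewrite derive1E; have := dF _ t0 => d; rewrite derive_val.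
have cF' (t : R) : 0 < t -> {for t, continuous F'}.
  move=> t0; have c_pow : {for t, continuous (fun x : R => x `^ (p - 1))}.
    apply: differentiable_continuous; apply/derivable1_diffP.
    by have d := is_derive1_powR (p - 1) t0; exact: ex_derive.
  by do 2!apply: cvgMr.
have -> : (a / c) `^ p = F a 
  by rewrite powRM ?invr_ge0 ?ltW // -powR_inv1 ?ltW // -powRrM mulN1r mulrC.
have nearF' (t : R) : 0 < t -> {near t, F' =1 F^`()%classic}.
  by move=> t0; near=> u; rewrite F'E //; near: u; exact: lt_nbhsr.
rewrite (@increasing_ge0_integration_by_substitutiony R F G a); last 8 first.
- move=> x y; rewrite !in_itv /= !andbT => ax ay xy.
  rewrite ltr_pM2l // gt0_ltr_powR // nnegrE; exact: le_trans (ltW a0) _.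
- move=> t; rewrite in_itv /= andbT => at0.
  have t0 : 0 < t by exact: lt_trans at0.
  rewrite /continuous_at F'E //; apply: cvg_trans (cF' _ t0).
  by apply: near_eq_cvg; exact: nearF'.
- apply/cvg_ex; exists (F' a); apply: cvg_at_right_filter.
  apply: cvg_trans (cF' _ a0); apply: near_eq_cvg; exact: nearF'.
- apply/cvg_ex; exists (q * (p * 0)).
  apply: (@cvg_trans _ (F' x @[x --> +oo])).
    by apply: near_eq_cvg; near=> x; rewrite F'E.
  by do 2!apply: cvgMr; apply: cvg_powR_neg; rewrite subr_lt0.
- split.
    move=> x; rewrite in_itv /= andbT => ax.
    by have := dF x (lt_trans a0 ax) => d; exact: ex_derive.
  apply: cvg_at_right_filter.
  have : {for a, continuous F} by apply: differentiable_continuous;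
    apply/derivable1_diffP; have d := dF _ a0; exact: ex_derive.
  by [].
- by apply: gt0_cvgMry => //; exact: cvg_powR_pinfty.
- by apply: continuous_subspaceT; exact: continuous_exp_power.
- by move=> x _; exact: expR_ge0.
rewrite -ge0_integralZl //=; last 3 first.
- by apply/measurable_EFinP; exact: measurable_gamma_density.
- by move=> x _; rewrite lee_fin mulr_ge0 ?powR_ge0 ?expR_ge0.
- by rewrite lee_fin mulr_ge0 ?ltW.
apply: eq_integral => x; rewrite inE /= in_itv /= andbT => ax.
have x0 : 0 < x by exact: lt_le_trans ax.
rewrite -EFinM; congr _%:E.
have root (y : R) : 0 < y -> (y `^ p) ^+ k = y.
  by move=> y0; exact: powR_root_expr (ltnW k1) (ltW y0).
have FxE : c * F x ^+ k = x.
  rewrite /F exprMn (root x x0) /q powRN exprVn (root c c0) mulrA divff ?gt_eqF //.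
  by rewrite mul1r.
rewrite [LHS](_ : _ = G (F x) * F^`()%classic x) // F'E // /G FxE /F'.
by rewrite mulrC !mulrA.
Unshelve. all: by end_near. Qed.

(** Monotone convergence over half-lines growing to the open one. *)
Lemma cvg_integral_itvcy (u : R^nat) (f : R -> R) :
  {homo u : i j / (i <= j)%N >-> j <= i} -> (forall i, 0 < u i) -> u @ \oo --> 0 ->
  (forall x, 0 <= f x) -> measurable_fun setT f ->
  (\int[mu]_(x in `[u i, +oo[) (f x)%:E)%E @[i --> \oo] -->
  (\int[mu]_(x in `]0%R, +oo[) (f x)%:E)%E.
Proof.
move=> u_homo u_gt0 u0 f0 mf.
rewrite (_ : `]0%R, +oo[%classic = \bigcup_i `[u i, +oo[%classic).
  apply: ge0_nondecreasing_set_cvg_integral => //.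
  - move=> i j ij; rewrite subsetEset => x /=; rewrite !in_itv /= !andbT.
    by apply: le_trans; exact: u_homo.
  - by move=> i; apply/measurable_EFinP; exact: measurable_funTS.
  - by move=> i x _; rewrite lee_fin.
apply/seteqP; split => x /=; rewrite in_itv /= andbT.
  move=> x0; have : \forall i \near \oo, u i < x by exact: cvgr_lt u0 _ x0.
  by move=> [i _ /(_ i (leqnn _)) /ltW ux]; exists i => //=; rewrite in_itv /= andbT.
by move=> [i _] /=; rewrite in_itv /= andbT; exact: lt_le_trans.
Qed.

(** The cutoff in the substitution is sent to 0 on both sides, and the two limits agree. *)
Lemma integral_exp_power (k : nat) (c : R) : (1 < k)%N -> 0 < c ->
  (\int[mu]_(x in `[0%R, +oo[) (expR (- (c * x ^+ k)))%:E =
  ((c `^ - k%:R^-1) / k%:R)%:E *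
  \int[mu]_(x in `]0%R, +oo[) (x `^ (k%:R^-1 - 1) * expR (- x))%:E)%E.
Proof.
move=> k1 c0; set p : R := k%:R^-1.
have p0 : 0 < p by rewrite invr_gt0 ltr0n ltnW.
have mG : measurable_fun setT (fun x : R => expR (- (c * x ^+ k))).
  by apply: continuous_measurable_fun; exact: continuous_exp_power.
(* [a i] is the cutoff in the variable of Euler's integral, and [u i] below is its image in the
   original variable. *)
pose a (i : nat) : R := i.+1%:R^-1.
have a_gt0 i : 0 < a i by rewrite invr_gt0.
have a_homo : {homo a : i j / (i <= j)%N >-> j <= i}.
  by move=> i j ij; rewrite lef_pV2 ?posrE // ler_nat.
have a0 : a @ \oo --> 0 by exact: cvg_harmonic.
pose u i := (a i / c) `^ p.
have u_gt0 i : 0 < u i by rewrite powR_gt0 // divr_gt0.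
have u_homo : {homo u : i j / (i <= j)%N >-> j <= i}.
  move=> i j ij; apply: ge0_ler_powR;
    rewrite ?nnegrE ?divr_ge0 ?(ltW p0) ?(ltW c0) ?(ltW (a_gt0 _)) //.
  by rewrite ler_pM2r ?invr_gt0 // a_homo.
have u0 : u @ \oo --> 0.
  apply: (cvg_at_rightP (fun x => x `^ p) 0 0).1; first exact: powR_cvg0.
  split; first by move=> i; rewrite divr_gt0.
  by rewrite -[X in _ --> X](mul0r c^-1); apply: cvgMl.
rewrite -integral_itv_obnd_cbnd; last first.
  by apply/measurable_EFinP; exact: measurable_funTS.
have := cvg_integral_itvcy u_homo u_gt0 u0 (fun x => expR_ge0 _) mG.
have cG : (\int[mu]_(x in `[a i, +oo[) (x `^ (p - 1) * expR (- x))%:E)%E @[i -->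
  \oo] -->
  (\int[mu]_(x in `]0%R, +oo[) (x `^ (p - 1) * expR (- x))%:E)%E.
  apply: cvg_integral_itvcy => //; last exact: measurable_gamma_density.
  by move=> x; rewrite mulr_ge0 ?powR_ge0 ?expR_ge0.
rewrite (_ : (fun i => _) = fun i => (((c `^ - p) / k%:R)%:E *
  \int[mu]_(x in `[a i, +oo[) (x `^ (p - 1) * expR (- x))%:E)%E); last first.
  by apply/funext => i; exact: integral_exp_power_itvcy.
move=> cu.
have cv : (((c `^ - p) / k%:R)%:E * \int[mu]_(x in `[a i, +oo[) (x `^ (p - 1) *
  expR (- x))%:E)%E
     @[i --> \oo] -->
  (((c `^ - p) / k%:R)%:E * \int[mu]_(x in `]0%R, +oo[) (x `^ (p - 1) * expR (-
    x))%:E)%E.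
  exact: cvgeZl.
exact: cvg_unique cu cv.
Qed.

End power_exponential_integral.

(** * Exponential bounds on the Gamma tails *)

Lemma le_of_derive_ge0 (R : realType) (f df : R -> R) (x y : R) :
  (forall z : R, is_derive z 1 f (df z)) -> x <= y ->
  (forall z : R, x <= z <= y -> 0 <= df z) -> f x <= f y.
Proof.
move=> dfE xy df0.
have cf : {within `[x, y], continuous f}.
  apply: continuous_subspaceT => z; apply: differentiable_continuous.
  by apply/derivable1_diffP; exact: ex_derive.
have [z zxy E] := MVT_segment xy (fun z _ => dfE z) cf.
rewrite -subr_ge0 E mulr_ge0 ?subr_ge0 // df0 //.
Qed.

Section gamma_tail_bounds.
Context {R : realType}.
Implicit Types (c : nat) (x y : R).

Lemma gamma_tail_nonincr c x y : 0 <= x -> x <= y -> gamma_tail c y <= gamma_tail c x.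
Proof.
move=> x0 xy; rewrite -lerN2.
apply: (@le_of_derive_ge0 _ (fun z => - gamma_tail c z)
  (fun z => gamma_tail c z - gamma_tail c.-1 z)) => //.
  by move=> z; rewrite -opprB; exact: is_deriveN.
move=> z /andP[xz _]; rewrite subr_ge0 gamma_tail_pred_le //; exact: le_trans xz.
Qed.

Lemma gamma_tail_le1 c x : 0 <= x -> gamma_tail c x <= 1.
Proof.
case: c => [|c] x0; first by rewrite gamma_tail0.
by rewrite -(@gamma_tail_at0 R c.+1) // gamma_tail_nonincr.
Qed.

Lemma expRN_le_gamma_tail c x : 0 <= x -> expR (- x) <= gamma_tail c.+1 x.
Proof.
move=> x0; rewrite /gamma_tail ler_peMr ?expR_ge0 // big_ord_recl /= expr0 fact0
  divr1.
by rewrite lerDl sumr_ge0 // => a _; rewrite divr_ge0 ?exprn_ge0.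
Qed.

(** The quotient of the tail by the candidate bound exp(- b x^k / k!) with k = c + 1. It equals 1 at
    0, so its monotonicity decides which of the two is larger. *)
Let tilted c (b x : R) := gamma_tail c.+1 x * expR (b * (x ^+ c.+1 / c.+1`!%:R)).

(** The tail has derivative - exp(- x) x^c / c!, so x^c / c! factors out and the sign is that of the
    last factor. *)
Let is_derive_tilted c b x : is_derive x 1 (tilted c b)
  (expR (b * (x ^+ c.+1 / c.+1`!%:R)) * (x ^+ c / c`!%:R) *
   (b * gamma_tail c.+1 x - expR (- x))).
Proof.
have dp : is_derive x 1 (fun y : R => b * (y ^+ c.+1 / c.+1`!%:R)) (b * (x ^+ c /
  c`!%:R)).
  have -> : (fun y : R => b * (y ^+ c.+1 / c.+1`!%:R)) =
    b \*: (fun y : R => y ^+ c.+1 / c.+1`!%:R) by [].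
  by apply: is_derive_eq.
have de : is_derive x 1 (fun y : R => expR (b * (y ^+ c.+1 / c.+1`!%:R)))
   (expR (b * (x ^+ c.+1 / c.+1`!%:R)) * (b * (x ^+ c / c`!%:R))).
  exact: (@is_derive1_comp _ expR).
have -> : tilted c b = gamma_tail c.+1 * (fun y : R => expR (b * (y ^+ c.+1 /
  c.+1`!%:R))) by [].
apply: is_derive_eq; rewrite /GRing.scale /= {2}gamma_tailS.
ring.
Qed.

Let tilted0 c b : tilted c b 0 = 1.
Proof. by rewrite /tilted gamma_tail_at0 // expr0n /= mul0r mulr0 expR0 mulr1. Qed.

(** With [b = 1] the quotient is nondecreasing, since the tail is at least exp(- x). *)
Lemma gamma_tail_ge_expR c x : 0 <= x ->
  expR (- (x ^+ c.+1 / c.+1`!%:R)) <= gamma_tail c.+1 x.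
Proof.
move=> x0; rewrite expRN -[leLHS]mul1r ler_pdivrMr ?expR_gt0 //.
have := le_of_derive_ge0 (is_derive_tilted c 1) x0;
  rewrite tilted0 /tilted mul1r; apply.
move=> z /andP[z0 _]; rewrite mulr_ge0 //.
  by rewrite mulr_ge0 ?expR_ge0 ?divr_ge0 ?exprn_ge0.
by rewrite mul1r subr_ge0 expRN_le_gamma_tail.
Qed.

(** With [b = expR (- y)] the quotient is nonincreasing up to [y]: the tail is at most 1, and exp(-
    y) is at most exp(- z) for z up to [y]. *)
Lemma gamma_tail_le_expR c x y : 0 <= x -> x <= y ->
  gamma_tail c.+1 x <= expR (- (expR (- y) * (x ^+ c.+1 / c.+1`!%:R))).
Proof.
move=> x0 xy; rewrite expRN -[leRHS]mul1r ler_pdivlMr ?expR_gt0 //.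
rewrite -/(tilted c (expR (- y)) x) -[leRHS](tilted0 c (expR (- y))) -lerN2.
apply: (@le_of_derive_ge0 _ (fun z => - tilted c (expR (- y)) z) (fun z =>
  - (expR (expR (- y) * (z ^+ c.+1 / c.+1`!%:R)) * (z ^+ c / c`!%:R) *
   (expR (- y) * gamma_tail c.+1 z - expR (- z))))) => //.
  by move=> z; exact: is_deriveN.
move=> z /andP[z0 zx]; rewrite -mulrN opprB mulr_ge0 //.
  by rewrite mulr_ge0 ?expR_ge0 ?divr_ge0 ?exprn_ge0.
rewrite subr_ge0 (@le_trans _ _ (expR (- y))) //.
  by rewrite ler_piMr ?expR_ge0 // gamma_tail_le1.
by rewrite ler_expR lerN2 (le_trans zx).
Qed.

End gamma_tail_bounds.

(** * Bounds on the mean alive time of a node *)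

Section mean_alive_time_bounds.
Context {R : realType}.
Notation mu := (@lebesgue_measure R).

Lemma mean_alive_time_ge0 k i : (0 <= mean_alive_time (R := R) k i)%E.
Proof.
apply: integral_ge0 => x; rewrite /= in_itv /= andbT => x0.
by rewrite lee_fin exprn_ge0 // gamma_tail_ge0.
Qed.

(** It is one term of a nonnegative sum equal to a mean number of cuts, which is a finite sum over
    runs and hence real. *)
Lemma mean_alive_time_fin_num k i : mean_alive_time (R := R) k i.+1 \is a fin_num.
Proof.
rewrite ge0_fin_numE ?mean_alive_time_ge0 //.
apply: (@le_lt_trans _ _ (\sum_(1 <= j < i.+2) mean_alive_time k j)%E).
  by rewrite big_nat_recr //= leeDr // sume_ge0 // => j _; exact: mean_alive_time_ge0.
by rewrite -path_expectation kcut_number_expectation ltry.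
Qed.

Lemma measurable_gamma_tailX k i (D : set R) :
  measurable_fun D (fun x : R => gamma_tail k x ^+ i).
Proof.
apply: measurable_funTS; apply: measurable_funX; apply: continuous_measurable_fun.
exact: continuous_gamma_tail.
Qed.

Lemma measurable_exp_power k (c : R) (D : set R) :
  measurable_fun D (fun x : R => expR (- (c * x ^+ k))).
Proof.
apply: measurable_funTS; apply: continuous_measurable_fun.
exact: continuous_exp_power.
Qed.

Lemma mean_alive_time_ge k i : (0 < k)%N ->
  (\int[mu]_(x in `[0%R, +oo[) (expR (- (i%:R / k`!%:R * x ^+ k)))%:E <=
   mean_alive_time k i)%E.
Proof.
case: k => // c _; apply: ge0_le_integral => //=.
- by apply/measurable_EFinP; exact: measurable_exp_power.
- by apply/measurable_EFinP; exact: measurable_gamma_tailX.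
move=> x; rewrite in_itv /= andbT => x0; rewrite lee_fin.
rewrite (_ : - _ = i%:R * - (x ^+ c.+1 / c.+1`!%:R));
  last by rewrite mulrN mulrAC mulrA.
by rewrite expRM_natl lerXn2r ?nnegrE ?expR_ge0 ?gamma_tail_ge0 // gamma_tail_ge_expR.
Qed.

(* Up to time d the tail is at most exp(- exp(- d) x^k / k!); after time d all
   factors but one are at most gamma_tail k d. *)
Lemma mean_alive_time_le k i (d : R) : (0 < k)%N -> 0 <= d ->
  (mean_alive_time k i.+1 <=
   \int[mu]_(x in `[0%R, +oo[) (expR (- (expR (- d) * i.+1%:R / k`!%:R * x ^+
     k)))%:E +
   (gamma_tail k d ^+ i)%:E * mean_alive_time k 1)%E.
Proof.
case: k => // c _ d0; rewrite /mean_alive_time.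
have nn (x : R) : x \in `[0%R, +oo[ -> 0 <= gamma_tail c.+1 x.
  by rewrite in_itv /= andbT; exact: gamma_tail_ge0.
rewrite -ge0_integralZl //=; last 2 first.
- by apply/measurable_EFinP; exact: measurable_gamma_tailX.
- by rewrite lee_fin exprn_ge0 // gamma_tail_ge0.
have mE : measurable_fun `[(0 : R), +oo[ (fun x : R => expR (- (expR (- d) *
  i.+1%:R / c.+1`!%:R * x ^+ c.+1))).
  exact: measurable_exp_power.
have mQ : measurable_fun `[(0 : R), +oo[ (fun x : R => gamma_tail c.+1 d ^+ i *
  gamma_tail c.+1 x ^+ 1).
  by apply: measurable_funM => //; exact: measurable_gamma_tailX.
rewrite -ge0_integralD //=; last 3 first.
- exact/measurable_EFinP.
- by move=> x /nn x0; rewrite -EFinM lee_fin mulr_ge0 // exprn_ge0 // gamma_tail_ge0.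
- exact/measurable_EFinP.
apply: ge0_le_integral => //=.
- by move=> x /nn x0; rewrite lee_fin exprn_ge0.
- by apply/measurable_EFinP; exact: measurable_gamma_tailX.
- by apply/measurable_EFinP; exact: measurable_funD.
move=> x; rewrite in_itv /= andbT => x0; rewrite -EFinM -EFinD lee_fin.
have [xd|dx] := leP x d.
  rewrite (_ : - _ = i.+1%:R * - (expR (- d) * (x ^+ c.+1 / c.+1`!%:R)));
    last by ring.
  rewrite expRM_natl (@le_trans _ _ (expR (- (expR (- d) * (x ^+ c.+1 /
    c.+1`!%:R))) ^+ i.+1)) //.
    by rewrite lerXn2r ?nnegrE ?expR_ge0 ?gamma_tail_ge0 // gamma_tail_le_expR.
  by rewrite lerDl mulr_ge0 ?exprn_ge0 ?gamma_tail_ge0.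
rewrite (@le_trans _ _ (gamma_tail c.+1 d ^+ i * gamma_tail c.+1 x ^+ 1)) //.
  rewrite exprSr expr1 ler_wpM2r ?gamma_tail_ge0 //.
  by rewrite lerXn2r ?nnegrE ?gamma_tail_ge0 // gamma_tail_nonincr // ltW.
by rewrite lerDr expR_ge0.
Qed.

End mean_alive_time_bounds.

(** * Mean alive times in terms of the Gamma function *)

Section mean_alive_time_gamma.
Context {R : realType} (k : nat) (k1 : (1 < k)%N).
Notation mu := (@lebesgue_measure R).
Notation p := (k%:R^-1 : R).

Let euler : \bar R := \int[mu]_(x in `]0%R, +oo[) (x `^ (p - 1) * expR (- x))%:E.

Let k_gt0 : (0 < k)%N. Proof. exact: ltnW. Qed.

Let fact_gt0R : 0 < k`!%:R :> R. Proof. by rewrite ltr0n fact_gt0. Qed.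

Let kR_gt0 : 0 < k%:R :> R. Proof. by rewrite ltr0n. Qed.

(** Otherwise the lower bound on the alive time of the root would be infinite, although that time is
    finite. This lets [Gamma], a real-valued integral, be identified with [euler]. *)
Let euler_fin_num : euler \is a fin_num.
Proof.
have e0 : (0 <= euler)%E.
  by apply: integral_ge0 => x _; rewrite lee_fin mulr_ge0 ?powR_ge0 ?expR_ge0.
rewrite ge0_fin_numE // ltey; apply/eqP => ey.
have := mean_alive_time_ge (R := R) 1 k_gt0.
rewrite integral_exp_power ?divr_gt0 // -/euler ey gt0_muley; last first.
  by rewrite lte_fin divr_gt0 ?powR_gt0 ?divr_gt0.
by rewrite leye_eq => /eqP E; have := mean_alive_time_fin_num (R := R) k 0; rewrite E.
Qed.

Let eulerE : euler = (Gamma p)%:E.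
Proof. by rewrite /Gamma /Rintegral -/euler fineK. Qed.

(** It is a positive multiple of the integral of exp(- x^k), which is at least exp(- 1) already over
    [0, 1]. *)
Lemma Gamma_inv_gt0 : 0 < Gamma p.
Proof.
have J0 : (0 < \int[mu]_(x in `[0%R, +oo[) (expR (- (1 * x ^+ k)))%:E)%E.
  apply: (@lt_le_trans _ _ (\int[mu]_(x in `[0%R, 1%R]) (cst (expR (-1))%:E x))%E).
    by rewrite integral_cst //= lebesgue_measure_itv /= lte_fin ltr01 oppr0 adde0
      mule1 lte_fin expR_gt0.
  apply: (@le_trans _ _ (\int[mu]_(x in `[0%R, 1%R]) (expR (- (1 * x ^+ k)))%:E)%E).
    apply: ge0_le_integral => //=.
    - by apply/measurable_EFinP; exact: measurable_exp_power.
    - move=> x; rewrite in_itv /= => /andP[x0 x1];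
      rewrite lee_fin ler_expR lerN2 mul1r.
      by rewrite exprn_ile1.
  apply: ge0_subset_integral => //=.
  - by apply/measurable_EFinP; exact: measurable_exp_power.
  - by move=> x /=; rewrite !in_itv /= => /andP[->].
move: J0; rewrite integral_exp_power // -/euler eulerE -EFinM lte_fin.
by rewrite pmulr_rgt0 // divr_gt0 ?powR_gt0.
Qed.

Lemma mean_alive_time_ge_powR i :
  k`!%:R `^ p / k%:R * Gamma p * i.+1%:R `^ (- p) <= fine (mean_alive_time k i.+1).
Proof.
rewrite -lee_fin fineK ?mean_alive_time_fin_num //.
apply: le_trans (mean_alive_time_ge _ k_gt0).
rewrite integral_exp_power ?divr_gt0 // -/euler eulerE -EFinM lee_fin.
rewrite powRM ?invr_ge0 // -[k`!%:R^-1]powR_inv1 // -powRrM mulrNN mul1r.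
by rewrite le_eqVlt; apply/orP; left; apply/eqP; ring.
Qed.

(** The factor [expR (- d)] in the exponent, raised to the power [- p], yields the loss
    [expR (d * p)]. *)
Lemma mean_alive_time_le_powR i (d : R) : 0 <= d ->
  fine (mean_alive_time k i.+1) <=
  expR (d * p) * (k`!%:R `^ p / k%:R * Gamma p) * i.+1%:R `^ (- p) +
  gamma_tail k d ^+ i * fine (mean_alive_time (R := R) k 1).
Proof.
move=> d0; rewrite -lee_fin fineK ?mean_alive_time_fin_num //.
apply: le_trans (mean_alive_time_le _ k_gt0 d0) _.
rewrite integral_exp_power ?divr_gt0 ?mulr_gt0 ?expR_gt0 // -/euler eulerE.
rewrite -[X in (_ + _ * X)%E]fineK ?mean_alive_time_fin_num // -!EFinM -EFinD
  lee_fin lerD2r.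
rewrite powRM ?invr_ge0 ?mulr_ge0 ?expR_ge0 // powRM ?expR_ge0 //.
rewrite -[k`!%:R^-1]powR_inv1 // -powRrM mulrNN mul1r -expRM mulrNN.
by rewrite le_eqVlt; apply/orP; left; apply/eqP; ring.
Qed.

End mean_alive_time_gamma.

(** * Power sums and harmonic sums *)

Section power_sums.
Context {R : realType}.

Lemma powR_increment (s : R) (i : nat) : 0 < s < 1 ->
  s * i.+2%:R `^ (s - 1) <= i.+2%:R `^ s - i.+1%:R `^ s <= s * i.+1%:R `^ (s - 1).
Proof.
move=> /andP[s0 s1].
have pos (z : R) : i.+1%:R <= z -> 0 < z by apply: lt_le_trans.
have d (z : R) : 0 < z -> is_derive z 1 (fun x : R => x `^ s) (s * z `^ (s - 1)).
  by move=> z0; exact: is_derive1_powR.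
have le12 : i.+1%:R <= i.+2%:R :> R by rewrite ler_nat.
have [||z] := @MVT_segment R (fun x => x `^ s) (fun z => s * z `^ (s - 1)) _ _ le12.
- by move=> z; rewrite in_itv /= => /andP[/ltW/pos z0 _]; exact: d.
- apply: derivable_within_continuous => z; rewrite in_itv /= => /andP[/pos z0 _].
  by have dz := d _ z0; exact: ex_derive.
rewrite in_itv /= => /andP[iz zi] ->; have z0 := pos _ iz.
rewrite -natrB // subSnn mulr1 !ler_pM2l //.
have mono (x y : R) : 0 < x -> x <= y -> y `^ (s - 1) <= x `^ (s - 1).
  move=> x0 xy; have y0 := lt_le_trans x0 xy.
  rewrite -(opprB 1 s) !powRN lef_pV2 ?posrE ?powR_gt0 //.
  by apply: ge0_ler_powR; rewrite ?nnegrE ?subr_ge0 ?(ltW s1) ?(ltW x0) ?(ltW y0).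
by rewrite !mono.
Qed.

(** The increments of [x ^ s] telescope; the first term is handled by [s < 1]. *)
Lemma sum_powR_bounds (s : R) (n : nat) : 0 < s < 1 ->
  n.+2%:R `^ s - 1 <= s * \sum_(1 <= i < n.+2) i%:R `^ (s - 1) <= n.+1%:R `^ s.
Proof.
move=> s01; have /andP[s0 s1] := s01; elim: n => [|n /andP[IH1 IH2]].
  have /andP[_] := powR_increment 0 s01.
  rewrite big_nat1 !powR1 mulr1 => h.
  by rewrite h ltW.
have /andP[lo _] := powR_increment n s01.
have /andP[_ up] := powR_increment n.+1 s01.
rewrite big_nat_recr //= mulrDr; move: lo up IH1 IH2.
move: (s * _) (s * _) (_ `^ s) (_ `^ s) (_ `^ s) => ? ? ? ? ?; lra.
Qed.

Lemma ln_increment (i : nat) :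
  i.+2%:R^-1 <= ln (i.+2%:R : R) - ln (i.+1%:R : R) <= i.+1%:R^-1.
Proof.
have pos (z : R) : i.+1%:R <= z -> 0 < z by apply: lt_le_trans.
have le12 : i.+1%:R <= i.+2%:R :> R by rewrite ler_nat.
have [||z] := @MVT_segment R (@ln R) (fun z => z^-1) _ _ le12.
- by move=> z; rewrite in_itv /= => /andP[/ltW/pos z0 _]; exact: is_derive1_ln.
- apply: derivable_within_continuous => z; rewrite in_itv /= => /andP[/pos z0 _].
  by have dz := is_derive1_ln z0; exact: ex_derive.
rewrite in_itv /= => /andP[iz zi] ->; have z0 := pos _ iz.
by rewrite -natrB // subSnn mulr1 !lef_pV2 ?posrE // iz zi.
Qed.

Lemma harmonic_sum_bounds (n : nat) :
  ln (n.+2%:R : R) <= \sum_(1 <= i < n.+2) i%:R^-1 <= 1 + ln (n.+1%:R : R).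
Proof.
elim: n => [|n /andP[IH1 IH2]].
  have /andP[_] := ln_increment 0.
  by rewrite big_nat1 ln1 subr0 addr0 invr1 => ->; rewrite lexx.
have /andP[lo _] := ln_increment n; have /andP[_ up] := ln_increment n.+1.
rewrite big_nat_recr //=; move: lo up IH1 IH2.
move: (\sum_(1 <= i < n.+2) _) (n.+2%:R^-1) (ln _) (ln _) (ln _) => ? ? ? ? ?; lra.
Qed.

End power_sums.

(** * Asymptotics of the expectation on the path *)

Lemma equiv_of_le (R : realType) (f g : nat -> R^o) :
  g @ \oo --> +oo ->
  (forall e : R, 0 < e -> exists K : R, forall n, `|f n - g n| <= e * g n + K) ->
  f ~_\oo g.
Proof.
move=> goo fg; apply/eqaddoP => e e0.
(* Half of [e] covers the relative error, and the other half absorbs [K] once [g n] is large. *)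
have [K fgK] := fg _ (divr_gt0 e0 (ltr0n R 2)).
have e20 : 0 < e / 2 by rewrite divr_gt0.
near=> n.
have g0 : 0 <= g n by near: n; apply: (cvgry_ge goo).
have gK : K / (e / 2) <= g n by near: n; apply: (cvgry_ge goo).
apply: le_trans (fgK n) _; rewrite ger0_norm //.
move: gK; rewrite ler_pdivrMr // => gK.
move: (g n) gK => ? ?; lra.
Unshelve. all: by end_near. Qed.

Section path_asymptotics.
Context {R : realType}.

Lemma fine_path_expectation k n :
  fine ('E_(kcut_prob R k (path_graph n))[kcut_number R k (path_graph n)])%E =
  \sum_(1 <= i < n.+2) fine (mean_alive_time (R := R) k i).
Proof.
rewrite path_expectation !big_add1 /= -[RHS]/(fine (_)%:E) -sumEFin; congr fine.
by apply: eq_bigr => i _; rewrite fineK // mean_alive_time_fin_num.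
Qed.

(** For [k = 1] any cut of a prefix node puts a zero factor in the product, so only the constant 1
    of the integral identity remains. *)
Lemma mean_alive_time1 i : mean_alive_time (R := R) 1 i.+1 = (i.+1%:R^-1)%:E.
Proof.
have := @integral_prod_gamma_tail R nat (iota 0 i.+1) (fun=> 1%N) (iota_uniq _ _)
  isT (fun _ _ => isT).
rewrite size_iota big_seq big1 => [|v vs]; last first.
  apply: integral0_eq => x _; congr _%:E.
  by rewrite (big_rem v) //= eqxx subnn gamma_tail0 mul0r.
rewrite adde0 [X in (_ * X)%E](_ : _ = mean_alive_time 1 i.+1); last first.
  by apply: eq_integral => x _;
    rewrite big_const_seq count_predT size_iota iter_mulr_1.
rewrite -[mean_alive_time _ _]fineK ?mean_alive_time_fin_num //.
rewrite -EFinM => -[E]; congr _%:E; apply: (mulfI (_ : i.+1%:R != 0)) => //.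
by rewrite E divff.
Qed.

Lemma cvg_ln_pinfty : @ln R x @[x --> +oo] --> +oo.
Proof.
apply/cvgryPge => A; near=> x.
have Ax : expR A <= x by near: x; apply: nbhs_pinfty_ge; rewrite num_real.
by rewrite -[A]expRK ler_ln ?posrE ?expR_gt0 // (lt_le_trans (expR_gt0 A)).
Unshelve. all: by end_near. Qed.

Lemma cvg_natS_pinfty : (n.+1%:R : R) @[n --> \oo] --> +oo.
Proof.
apply/cvgryPge => A; near=> n.
apply: (@le_trans _ _ n%:R); last by rewrite ler_nat.
by near: n; exact: (cvgry_ge (@cvgr_idn R)).
Unshelve. all: by end_near. Qed.

Lemma path_expectation_equiv1 :
  (fun n => fine ('E_(kcut_prob R 1 (path_graph n))[kcut_number R 1 (path_graph
    n)])%E)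
  ~_\oo (fun n => ln n.+1%:R : R^o).
Proof.
apply: equiv_of_le; first exact: cvg_comp cvg_natS_pinfty cvg_ln_pinfty.
move=> e e0; exists 1 => n; rewrite fine_path_expectation.
rewrite (_ : \sum_(1 <= i < n.+2) _ = \sum_(1 <= i < n.+2) i%:R^-1 :> R); last first.
  by rewrite !big_add1 /=; apply: eq_bigr => i _; rewrite mean_alive_time1.
have /andP[lo up] := harmonic_sum_bounds (R := R) n.
have ln0 : 0 <= ln (n.+1%:R : R) by rewrite ln_ge0 // ler1n.
have ln12 : ln (n.+1%:R : R) <= ln (n.+2%:R : R) by rewrite ler_ln ?posrE // ler_nat.
rewrite ger0_norm; last by rewrite subr_ge0 (le_trans ln12).
have : 0 <= e * ln (n.+1%:R : R) by rewrite mulr_ge0 // ltW.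
by move: up; move: (e * _) => ?; lra.
Qed.

Lemma sum_geometric_le (r : R) n : 0 <= r < 1 ->
  \sum_(1 <= i < n.+2) r ^+ i.-1 <= (1 - r)^-1.
Proof.
move=> /andP[r0 r1]; have r10 : 0 < 1 - r by rewrite subr_gt0.
rewrite big_add1 /= big_mkord -[leRHS]mul1r ler_pdivlMr // mulrC.
have := subrX1 r n.+1; rewrite -opprB => /eqP; rewrite eqr_oppLR => /eqP.
rewrite -mulNr opprB => <-.
by rewrite lerBlDr lerDl exprn_ge0.
Qed.

Lemma path_expectation_equiv k : (1 < k)%N ->
  (fun n => fine ('E_(kcut_prob R k (path_graph n))[kcut_number R k (path_graph
    n)])%E)
  ~_\oo (fun n => (k`!%:R `^ k%:R^-1) / (k%:R - 1) * Gamma k%:R^-1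
              * n.+1%:R `^ (1 - k%:R^-1) : R^o).
Proof.
move=> k1; set p : R := k%:R^-1; pose s := 1 - p.
have k0 : 0 < k%:R :> R by rewrite ltr0n ltnW.
have p0 : 0 < p by rewrite invr_gt0.
have p1 : p < 1 by rewrite invf_lt1 // ltr1n.
have s01 : 0 < s < 1 by rewrite subr_gt0 p1 /= ltrBlDr ltrDl.
have /andP[s0 _] := s01.
pose C := k`!%:R `^ p / k%:R * Gamma p.
have fact0 : 0 < k`!%:R :> R by rewrite ltr0n fact_gt0.
have C0 : 0 < C by rewrite mulr_gt0 ?Gamma_inv_gt0 ?divr_gt0 ?powR_gt0.
(* The constants agree because [k * s = k - 1]. *)
have -> : (fun n => k`!%:R `^ p / (k%:R - 1) * Gamma p * n.+1%:R `^ (1 - p) : R^o) =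
    fun n => C / s * n.+1%:R `^ s.
  apply/funext => n; rewrite -/s; congr (_ * _); rewrite /C /s /p; field.
  by rewrite gt_eqF //= gt_eqF // subr_gt0 ltr1n.
have cv_g : (C / s * n.+1%:R `^ s : R) @[n --> \oo] --> +oo.
  apply: (cvg_comp _ (fun x => C / s * x `^ s) cvg_natS_pinfty).
  by apply: gt0_cvgMry; [rewrite divr_gt0|exact: cvg_powR_pinfty].
apply: equiv_of_le => // e e0.
(* This [d] makes the loss factor [expR (d * p)] equal to [1 + e], while [r < 1] makes the
   contributions of times after [d] summable. *)
pose d := ln (1 + e) / p; pose r := gamma_tail k d;
  pose a1 := fine (mean_alive_time (R := R) k 1).
have d0 : 0 < d by rewrite divr_gt0 // ln_gt0 // ltrDl.
have r01 : 0 <= r < 1.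
  rewrite gamma_tail_ge0 ?ltW //=; case: (k) k1 @r {a1} => // c _ r.
  apply: le_lt_trans (gamma_tail_le_expR c (ltW d0) (lexx d)) _.
  by rewrite expR_lt1 oppr_lt0 mulr_gt0 ?expR_gt0 // divr_gt0 ?exprn_gt0 ?ltr0n
    ?fact_gt0.
have /andP[r0 r1] := r01.
have a10 : 0 <= a1 by rewrite fine_ge0 // mean_alive_time_ge0.
(* [C / s] pays for the [- 1] in the lower power sum bound, and [a1 / (1 - r)] for the geometric
   series. *)
exists (C / s + a1 / (1 - r)) => n; rewrite fine_path_expectation.
set E := \sum_(1 <= i < n.+2) _; set S := \sum_(1 <= i < n.+2) i%:R `^ (s - 1) : R.
have sp : s - 1 = - p by rewrite /s addrAC subrr sub0r.
have lo : C * S <= E.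
  rewrite mulr_sumr /E !big_add1 /=; apply: ler_sum => i _; rewrite sp.
  exact: mean_alive_time_ge_powR.
have up : E <= (1 + e) * C * S + a1 / (1 - r).
  apply: (@le_trans _ _ ((1 + e) * C * S + a1 * \sum_(1 <= i < n.+2) r ^+ i.-1));
    last first.
    by rewrite lerD2l ler_wpM2l // sum_geometric_le.
  rewrite !mulr_sumr -big_split /= /E !big_add1 /=; apply: ler_sum => i _; rewrite sp.
  have := mean_alive_time_le_powR k1 i (ltW d0).
  by rewrite -/p -/C /d divfK ?gt_eqF // lnK ?posrE ?addr_gt0 // [_ ^+ _ * _]mulrC.
have /andP[Slo Sup] := sum_powR_bounds n s01.
have mono : n.+1%:R `^ s <= n.+2%:R `^ s :> R.
  by apply: ge0_ler_powR; rewrite ?nnegrE ?(ltW s0) // ler_nat.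
have CS : C * S = C / s * (s * S) by field; rewrite gt_eqF.
have Cs0 : 0 < C / s by rewrite divr_gt0.
have CSlo : C / s * (n.+1%:R `^ s - 1) <= C * S.
  by rewrite CS ler_wpM2l ?(ltW Cs0) // (le_trans _ Slo) // lerD2r.
have CSup : C * S <= C / s * n.+1%:R `^ s by rewrite CS ler_wpM2l ?(ltW Cs0).
have eCS : e * (C * S) <= e * (C / s * n.+1%:R `^ s) by rewrite ler_wpM2l ?(ltW e0).
have t0 : 0 <= a1 / (1 - r) by rewrite divr_ge0 // subr_ge0 ltW.
have g0 : 0 <= e * (C / s * n.+1%:R `^ s) by rewrite mulr_ge0 ?(ltW e0) //
  mulr_ge0 ?powR_ge0 ?(ltW Cs0).
rewrite mulrBr mulr1 in CSlo.
rewrite -mulrA mulrDl mul1r in up.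
rewrite ler_norml.
move: lo up CSlo CSup eCS t0 g0 Cs0.
move: (a1 / _) (C / s) (C * S) (C / s * _) => ? ? ? ?.
move: (e * _) (e * _) => ? ?.
move=> *; apply/andP; split; lra.
Qed.

End path_asymptotics.

(** * Domination, the minimum over graphs, and the asymptotics together *)

Theorem lemma10 (R : realType) (k : nat) (hk : (1 <= k)%N) :
  [/\ (forall (n : nat) (G : rooted_graph n.+1),
         stoch_dominated (kcut_number R k (path_graph n)) (kcut_number R k G)),
      (forall n : nat,
         ('E_(kcut_prob R k (path_graph n))[kcut_number R k (path_graph n)]
          <= \big[Order.min/+oo]_(G : rooted_graph n.+1)
               'E_(kcut_prob R k G)[kcut_number R k G])%E) &
      (fun n : nat =>
         fine 'E_(kcut_prob R k (path_graph n))[kcut_number R k (path_graph n)])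
      ~_\oo
      (fun n : nat =>
         if k == 1%N then ln n.+1%:R
         else (k`!%:R `^ k%:R^-1) / (k%:R - 1) * Gamma k%:R^-1
              * n.+1%:R `^ (1 - k%:R^-1) : R^o) ].
Proof.
split.
(* Domination is the comparison of means for the nondecreasing indicator of having made at least [x]
   cuts. *)
- move=> n G x; rewrite [leLHS]kcut_prob_ge [leRHS]kcut_prob_ge lee_fin;
  apply: run_mean_path_min => i j ij.
  rewrite ler_nat; case: (leP x i%:R) => // xi.
  by rewrite (le_trans xi) // ler_nat.
(* The default [+oo] of the minimum is harmless as an upper value; each graph is compared through
   the number of cuts itself. *)
- move=> n; apply: le_bigmin; first exact: leey.
  move=> G _; rewrite !kcut_number_expectation lee_fin;
    apply: run_mean_path_min => i j ij.
  by rewrite ler_nat.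
- have [->|k1] := eqVneq k 1%N; first exact: path_expectation_equiv1.
  by apply: path_expectation_equiv; rewrite ltn_neqAle eq_sym k1.
Qed.
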